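(* Consider the discrete-time system $x(k+1)=f(x(k),u(k),w(k))$ described in the context, with control input set $\mathcal{U}=\bigcap_{k=1}^{N_u}\{u\in\mathbb{R}^{n_u}:\|\mathbf{U}_k u\|\le 1\}$ and exogenous input set $\mathcal{W}=\operatorname{co}\{w_1,\dots,w_{N_w}\}\ni0$. Let a point $c$ and a target set $\xi_+=\operatorname{E}(c_+,\mathbf{P}_+)$ be given, together with the stage cost function $$\mathcal{J}(x,u)=\begin{pmatrix}x^\top&u^\top&1\end{pmatrix}\mathbf{Q}\begin{pmatrix}x^\top&u^\top&1\end{pmatrix}^\top,\qquad \mathbf{Q}=\mathbf{S}^\top\mathbf{S}\succ0,$$ and $\lambda\in[0,1]$. Let $\bar u\in\mathcal{U}$ and let $\tilde f(x,u,w)=\mathbf{A}x+\mathbf{B}u+\mathbf{E}w+g$ be the linearization of $f$ around $\bar p=(c,\bar u,0)$. Then the solution of the convex optimization problem $$\inf_{\substack{\mathbf{L}\succ0,\ \mathbf{F},\ l,\ \delta_X\ge0,\ \delta_U\ge0,\\ \phi\ge0,\ \beta_{ij}\ge0,\ \tau_k\ge0,\ \gamma\ge0,\ \widetilde{\mathcal{J}}}}\ \lambda\widetilde{\mathcal{J}}+(1-\lambda)(-\log\det\mathbf{L})$$ subject to $$\begin{pmatrix}\mathbf{I}&\mathbf{L}\\ \bullet&\delta_X\mathbf{I}\end{pmatrix}\succeq0,\qquad \begin{pmatrix}\phi\mathbf{I}&0&\mathbf{F}^\top\\ \bullet&\delta_U-\phi&(l-\bar u)^\top\\ \bullet&\bullet&\mathbf{I}\end{pmatrix}\succeq0,$$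 $$\begin{pmatrix}\beta_{ij}\mathbf{I}&0&(\mathbf{A}\mathbf{L}+\mathbf{B}\mathbf{F})^\top\\ \bullet&1-\beta_{ij}&\mu^\top+V_i^\top+(\mathbf{E}w_j)^\top\\ \bullet&\bullet&\mathbf{P}_+^{-1}\end{pmatrix}\succeq0,\quad i\in\{1,\dots,2^{n_x}\},\ j\in\{1,\dots,N_w\},$$ $$\begin{pmatrix}\tau_k\mathbf{I}&0&\mathbf{F}^\top\mathbf{U}_k^\top\\ \bullet&1-\tau_k&l^\top\mathbf{U}_k^\top\\ \bullet&\bullet&\mathbf{I}\end{pmatrix}\succeq0,\quad k\in\{1,\dots,N_u\},$$ $$\begin{pmatrix}\gamma\mathbf{I}&0&[\mathbf{L},\ \mathbf{F}^\top,\ 0]\,\mathbf{S}^\top\\ \bullet&\widetilde{\mathcal{J}}-\gamma&[c^\top,\ l^\top,\ 1]\,\mathbf{S}^\top\\ \bullet&\bullet&\mathbf{I}\end{pmatrix}\succeq0$$ satisfies $$\widetilde{\mathcal{J}}\ge\max_{x\in\xi}\mathcal{J}(x,\kappa(x)),$$ where the controller $\kappa(x)=\mathbf{K}(x-c)+l\in\mathcal{U}$ with $\mathbf{K}=\mathbf{F}\mathbf{L}^{-1}$ ensures a transition from $\xi=\operatorname{E}(c,\mathbf{P})$, $\mathbf{P}=\mathbf{L}^{-2}$, to $\xi_+$; that is, $\kappa(\xi)\subseteq\mathcal{U}$ and $f(x,\kappa(x),w)\in\xi_+$ for all $x\in\xi$ and all $w\in\mathcal{W}$. Here $\mu=g+\mathbf{A}c+\mathbf{B}l-c_+$,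 the $V_i$ ($i=1,\dots,2^{n_x}$) are the vertices of $\operatorname{H}(0,\tfrac12L^{\mathrm{Lip}}r^2)$ with $r^2=\delta_X+\delta_U+\delta_W$, and $\delta_W=\max_{i}\|w_i\|^2$.
   Context: **System class.** $\mathcal{X}\subseteq\mathbb{R}^{n_x}$, $\mathcal{U}\subseteq\mathbb{R}^{n_u}$, $\mathcal{W}\subseteq\mathbb{R}^{n_w}$; $f:\mathcal{X}\times\mathcal{U}\times\mathcal{W}\to\mathcal{X}$ is a continuous nonlinear function whose Jacobian is globally Lipschitz continuous. $L^{\mathrm{Lip}}\in\mathbb{R}^{n_x}$ is the vector whose $i$-th entry is a Lipschitz constant of the gradient of the component $f_i$. The matrices $\mathbf{U}_k$ have appropriate dimensions, and $\operatorname{co}$ denotes the convex hull. The cells $\xi,\xi_+$ considered are subsets of $\mathcal{X}$, and $c\in\mathcal{X}$. **Variables.** $\mathbf{L}\in\mathbb{R}^{n_x\times n_x}$ is symmetric positive definite, $\mathbf{F}\in\mathbb{R}^{n_u\times n_x}$, $l\in\mathbb{R}^{n_u}$; $\mathbf{P}_+$ is positive definite. **Linearization.** For $\bar p=(\bar x,\bar u,\bar w)$, $\tilde f(x,u,w)=\mathbf{A}x+\mathbf{B}u+\mathbf{E}w+g$, where $\mathbf{A},\mathbf{B},\mathbf{E}$ are the Jacobian matrices of $f$ with respect to $x,u,w$ at $\bar p$ and $g=f(\bar x,\bar u,\bar w)-\mathbf{A}\bar x-\mathbf{B}\bar u-\mathbf{E}\bar w$. The following component-wise bound is used as known: for all $(x,u,w)\in\mathcal{X}\times\mathcal{U}\times\mathcal{W}$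 and all $i$, $|f_i(x,u,w)-\tilde f_i(x,u,w)|\le\tfrac12L^{\mathrm{Lip}}_i(\|x-\bar x\|^2+\|u-\bar u\|^2+\|w-\bar w\|^2)$. **Notation.** $\operatorname{E}(c,\mathbf{P})=\{x\in\mathbb{R}^n:(x-c)^\top\mathbf{P}(x-c)\le1\}$ for positive definite $\mathbf{P}$; $\operatorname{H}(c,h)=\{x\in\mathbb{R}^n:|x_i-c_i|\le h_i,\ i=1,\dots,n\}$, so the vertices of $\operatorname{H}(0,h)$ are the $2^{n}$ vectors $(\pm h_1,\dots,\pm h_n)$. $\|\cdot\|$ is the Euclidean norm; $\succeq0$ means positive semidefinite; $\bullet$ denotes a block determined by symmetry. *)

(* Defs.v *)
From HB Require Import structures.
From mathcomp Require Import all_boot all_order all_algebra.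
From mathcomp Require Import all_classical all_reals all_analysis.

Set Implicit Arguments.
Unset Strict Implicit.
Unset Printing Implicit Defensive.

Import Order.TTheory GRing.Theory Num.Theory.
Import numFieldNormedType.Exports.

Local Open Scope classical_set_scope.
Local Open Scope ring_scope.

(* The canonical norm on ['cV[R]_n] is the sup norm; only [enorm] is Euclidean. *)
Definition enorm (R : realType) (n : nat) (v : 'cV[R]_n) : R :=
  Num.sqrt (\sum_(i < n) v i 0 ^+ 2).

Definition qform (R : realType) (n : nat) (M : 'M[R]_n) (v : 'cV[R]_n) : R :=
  (v^T *m M *m v) 0 0.

Definition posdef (R : realType) (n : nat) (M : 'M[R]_n) : Prop :=
  M^T = M /\ forall v : 'cV[R]_n, v != 0 -> 0 < qform M v.

Definition possemidef (R : realType) (n : nat) (M : 'M[R]_n) : Prop :=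
  M^T = M /\ forall v : 'cV[R]_n, 0 <= qform M v.

Definition ellipsoid (R : realType) (n : nat) (c : 'cV[R]_n) (P : 'M[R]_n) :
    set 'cV[R]_n :=
  [set x | qform P (x - c) <= 1].

Definition conv_hull (R : realType) (n N : nat) (w : 'I_N -> 'cV[R]_n) :
    set 'cV[R]_n :=
  [set x | exists a : 'I_N -> R,
    [/\ forall j, 0 <= a j, \sum_j a j = 1 & x = \sum_j a j *: w j]].

Definition input_set (R : realType) (nu Nu : nat) (mU : 'I_Nu -> nat)
    (Uk : forall k, 'M[R]_(mU k, nu)) : set 'cV[R]_nu :=
  \bigcap_(k in [set: 'I_Nu]) [set u | enorm (Uk k *m u) <= 1].

(* The vertices of the box [H(0,h)], indexed by the 2^n sign patterns. *)
Definition box_vertex (R : realType) (n : nat) (h : 'cV[R]_n)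
    (s : {ffun 'I_n -> bool}) : 'cV[R]_n :=
  \col_i ((-1) ^+ s i * h i 0).

(* The matrix of partial derivatives; the library's [jacobian] is stated for
   row vectors and is the transpose of this one. *)
Definition jac (R : realType) (m n : nat) (F : 'cV[R]_n -> 'cV[R]_m)
    (x : 'cV[R]_n) : 'M[R]_(m, n) :=
  \matrix_(i < m, j < n) ('D_(delta_mx j 0) F x) i 0.

Section System.
Variables (R : realType) (nx nu nw : nat).

(* Points of the state-input-disturbance space are triples [(x, u, w)]. *)
Notation point := ('cV[R]_nx * 'cV[R]_nu * 'cV[R]_nw)%type.
Variable f : point -> 'cV[R]_nx.

Definition jac_x (p : point) : 'M[R]_(nx, nx) :=
  jac (fun x => f (x, p.1.2, p.2)) p.1.1.
Definition jac_u (p : point) : 'M[R]_(nx, nu) :=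
  jac (fun u => f (p.1.1, u, p.2)) p.1.2.
Definition jac_w (p : point) : 'M[R]_(nx, nw) :=
  jac (fun w => f (p.1.1, p.1.2, w)) p.2.

Definition grad (i : 'I_nx) (p : point) : 'cV[R]_(nx + nu + nw) :=
  (row i (row_mx (row_mx (jac_x p) (jac_u p)) (jac_w p)))^T.

Definition stack (p : point) : 'cV[R]_(nx + nu + nw) :=
  col_mx (col_mx p.1.1 p.1.2) p.2.

Definition lin_offset (p : point) : 'cV[R]_nx :=
  f p - jac_x p *m p.1.1 - jac_u p *m p.1.2 - jac_w p *m p.2.

(* [f] is a total function on the ambient space, of which only the values on
   [X * U * W] matter; since the factors may have empty interior or be closed,
   differentiability at a point of the domain is that of the ambient
   function. The Lipschitz bound is required on the domain only. *)
Definition smooth_system (X : set 'cV[R]_nx) (U : set 'cV[R]_nu)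
    (W : set 'cV[R]_nw) (Lip : 'cV[R]_nx) : Prop :=
  let D := X `*` U `*` W in
  [/\ forall p, D p -> X (f p),
      {within D, continuous f},
      forall p, D p -> differentiable f p,
      forall i, 0 <= Lip i 0
    & forall i p q, D p -> D q ->
        enorm (grad i p - grad i q) <= Lip i 0 * enorm (stack p - stack q)].

End System.

Definition stage_cost (R : realType) (nx nu : nat) (Q : 'M[R]_(nx + nu + 1))
    (x : 'cV[R]_nx) (u : 'cV[R]_nu) : R :=
  qform Q (col_mx (col_mx x u) 1%:M).

(* The symmetric block matrix
     ( a I  0  G )
     (  .   b  v )
     (  .   .  M )   with [M] symmetric. *)
Definition lmi_mx (R : realType) (n m : nat) (a b : R) (G : 'M[R]_(n, m))
    (v : 'rV[R]_m) (M : 'M[R]_m) : 'M[R]_(n + 1 + m) :=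
  block_mx (block_mx a%:M 0 0 b%:M) (col_mx G v) (row_mx G^T v^T) M.

Section Program.
Variables (R : realType) (nx nu nw Nu Nw ns : nat) (mU : 'I_Nu -> nat).

(* [(L, F, l, dX, dU, phi, beta, tau, gamma, Jt)]; a nested product, so as to
   be an [lmodType R], on which the library's convexity notions are defined. *)
Definition dvar : lmodType R :=
  ('M[R]_nx * 'M[R]_(nu, nx) * 'cV[R]_nu * R^o * R^o * R^o
   * {ffun {ffun 'I_nx -> bool} * 'I_Nw -> R^o} * {ffun 'I_Nu -> R^o}
   * R^o * R^o)%type.

Definition feasible (A : 'M[R]_nx) (B : 'M[R]_(nx, nu)) (E : 'M[R]_(nx, nw))
    (g : 'cV[R]_nx) (Lip : 'cV[R]_nx) (Uk : forall k, 'M[R]_(mU k, nu))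
    (ws : 'I_Nw -> 'cV[R]_nw) (c : 'cV[R]_nx) (ubar : 'cV[R]_nu)
    (cp : 'cV[R]_nx) (Pp : 'M[R]_nx) (S : 'M[R]_(ns, nx + nu + 1)) :
    set dvar :=
  [set y : dvar |
    let: (L, F, l, dX, dU, phi, beta, tau, gamma, Jt) := y in
    let dW := \big[Num.max/0]_(j < Nw) enorm (ws j) ^+ 2 in
    let r2 := dX + dU + dW in
    let mu := g + A *m c + B *m l - cp in
    let V := box_vertex ((2^-1 * r2) *: Lip) in
    (posdef L /\ [/\ 0 <= dX, 0 <= dU, 0 <= phi & 0 <= gamma]) /\
    ((forall ij, 0 <= beta ij) /\ (forall k, 0 <= tau k)) /\
    [/\ possemidef (block_mx 1%:M L L^T dX%:M),
        possemidef (lmi_mx phi (dU - phi) F^T (l - ubar)^T 1%:M),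
        forall i j, possemidef
          (lmi_mx (beta (i, j)) (1 - beta (i, j)) (A *m L + B *m F)^T
             (mu^T + (V i)^T + (E *m ws j)^T) (invmx Pp)),
        forall k, possemidef
          (lmi_mx (tau k) (1 - tau k) (F^T *m (Uk k)^T) (l^T *m (Uk k)^T) 1%:M)
      & possemidef
          (lmi_mx gamma (Jt - gamma)
             (row_mx (row_mx L F^T) (0 : 'M[R]_(nx, 1)) *m S^T)
             (row_mx (row_mx c^T l^T) 1%:M *m S^T) 1%:M)]].

Definition objective (lam : R) (y : dvar) : R^o :=
  let: (L, F, l, dX, dU, phi, beta, tau, gamma, Jt) := y in
  lam * Jt + (1 - lam) * (- ln (\det L)).

End Program.

Definition is_minimizer (R : realType) (T : Type) (D : set T) (h : T -> R)
    (y : T) : Prop :=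
  D y /\ forall z, D z -> h y <= h z.

Definition is_maximum (R : realType) (A : set R) (m : R) : Prop :=
  A m /\ ubound A m.

Definition ctrl (R : realType) (nx nu : nat) (K : 'M[R]_(nu, nx))
    (c : 'cV[R]_nx) (l : 'cV[R]_nu) (x : 'cV[R]_nx) : 'cV[R]_nu :=
  K *m (x - c) + l.

(* Main.v *)
Require Import Defs.
From HB Require Import structures.
From mathcomp Require Import all_boot all_order all_algebra.
From mathcomp Require Import all_classical all_reals all_analysis.
From mathcomp Require Import ring lra.

Set Implicit Arguments.
Unset Strict Implicit.
Unset Printing Implicit Defensive.

Import Order.TTheory GRing.Theory Num.Theory.
Import numFieldNormedType.Exports.

Local Open Scope classical_set_scope.
Local Open Scope ring_scope.

(** The linear matrix inequalities are read through Schur complements: testing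
    the matrix of a constraint at [(y, 1, - P d)] turns it into
    [qform P d <= 1] for all [y] of Euclidean norm at most 1, and
    [y |-> L y + c] maps the unit ball onto [xi]. The exact successor is the
    linearized one plus a remainder which, by Taylor's formula along the segment
    from [pbar] (which stays in [xi * U * W]), lies in the box; being a convex
    function, the quadratic form of [Pp] needs only be bounded at the
    pairs (vertex of the box, generator of [W]).
    The constraints are affine in the decision variables, so that convexity of
    the program reduces to concavity of [ln \det]. It follows by induction on
    the size: the Schur complement is a partial minimum of the quadratic form,
    hence superadditive. *)

(** * Quadratic forms *)

(** Rectangular [M] is allowed, so that the off-diagonal blocks of a block matrix are covered; for
    [M = 1%:M] this is the Euclidean inner product. *)
Definition bform (R : realType) (m n : nat) (M : 'M[R]_(m, n))
  (u : 'cV[R]_m) (v : 'cV[R]_n) : R := (u^T *m M *m v) 0 0.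

Section Forms.
Variable R : realType.

Lemma bformDl m n (M : 'M[R]_(m, n)) u1 u2 v :
  bform M (u1 + u2) v = bform M u1 v + bform M u2 v.
Proof. by rewrite /bform linearD /= !mulmxDl mxE. Qed.

Lemma bformZl m n (M : 'M[R]_(m, n)) a u v :
  bform M (a *: u) v = a * bform M u v.
Proof. by rewrite /bform linearZ /= -!scalemxAl mxE. Qed.

Lemma bformBl m n (M : 'M[R]_(m, n)) u1 u2 v :
  bform M (u1 - u2) v = bform M u1 v - bform M u2 v.
Proof. by rewrite bformDl -scaleN1r bformZl mulN1r. Qed.

Lemma bformDr m n (M : 'M[R]_(m, n)) u v1 v2 :
  bform M u (v1 + v2) = bform M u v1 + bform M u v2.
Proof. by rewrite /bform mulmxDr mxE. Qed.

Lemma bformZr m n (M : 'M[R]_(m, n)) a u v :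
  bform M u (a *: v) = a * bform M u v.
Proof. by rewrite /bform -scalemxAr mxE. Qed.

Lemma bform_suml m n (M : 'M[R]_(m, n)) (I : finType) (u : I -> 'cV[R]_m) v :
  bform M (\sum_i u i) v = \sum_i bform M (u i) v.
Proof. by rewrite /bform linear_sum /= !mulmx_suml summxE. Qed.

Lemma bform_tr m n (M : 'M[R]_(m, n)) u v : bform M u v = bform M^T v u.
Proof.
rewrite /bform -[in LHS]trace_mx11 -mxtrace_tr trace_mx11.
by rewrite !trmx_mul trmxK mulmxA.
Qed.

Lemma bformE n (u v : 'cV[R]_n) : bform 1%:M u v = \sum_i u i 0 * v i 0.
Proof. by rewrite /bform mulmx1 mxE; apply: eq_bigr => i _; rewrite mxE. Qed.

Lemma qformD n (M : 'M[R]_n) u v : M^T = M ->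
  qform M (u + v) = qform M u + 2 * bform M u v + qform M v.
Proof.
move=> sM; rewrite /qform -!/(bform _ _ _) bformDl !bformDr.
rewrite [bform M v u]bform_tr sM; ring.
Qed.

Lemma qformZ n (M : 'M[R]_n) a v : qform M (a *: v) = a ^+ 2 * qform M v.
Proof. rewrite /qform -!/(bform _ _ _) bformZl bformZr; ring. Qed.

Lemma qform_comb n (M N : 'M[R]_n) s t v :
  qform (s *: M + t *: N) v = s * qform M v + t * qform N v.
Proof. by rewrite /qform mulmxDr mulmxDl -!scalemxAr -!scalemxAl !mxE. Qed.

Lemma qform_mul m n (M : 'M[R]_m) (A : 'M[R]_(m, n)) v :
  qform (A^T *m M *m A) v = qform M (A *m v).
Proof. by rewrite /qform trmx_mul !mulmxA. Qed.

Lemma posdef_ge0 n (M : 'M[R]_n) v : posdef M -> 0 <= qform M v.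
Proof.
move=> [_ pM]; have [->|v0] := eqVneq v 0; last exact/ltW/pM.
by rewrite /qform mulmx0 mxE.
Qed.

Lemma posdef_possemidef n (M : 'M[R]_n) : posdef M -> possemidef M.
Proof. by move=> pM; split; [case: pM | move=> v; exact: posdef_ge0]. Qed.

Lemma posdef_unitmx n (M : 'M[R]_n) : posdef M -> M \in unitmx.
Proof.
move=> [sM pM]; rewrite -row_free_unit -kermx_eq0; apply/rowV0P => u.
move=> /sub_kermxP uM; apply/eqP; apply: contraT => u0.
have := pM u^T; rewrite trmx_eq0 u0 => /(_ isT).
by rewrite /qform trmxK uM mul0mx mxE ltxx.
Qed.

Lemma posdef_comb n (M N : 'M[R]_n) s t : 0 <= s -> 0 <= t -> s + t = 1 ->
  posdef M -> posdef N -> posdef (s *: M + t *: N).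
Proof.
move=> s0 t0 st1 pM pN; split; first by rewrite linearD !linearZ /= pM.1 pN.1.
move=> v v0; rewrite qform_comb.
have qM := pM.2 v v0; have qN := pN.2 v v0.
(* One weight may vanish: if [s = 0] then [t = 1], otherwise the first term is already positive. *)
have [se|sN] := eqVneq s 0.
  by move: st1; rewrite se add0r => ->; rewrite mul0r mul1r add0r.
have : 0 < s * qform M v by rewrite mulr_gt0 // lt_neqAle eq_sym sN.
by have : 0 <= t * qform N v by [rewrite mulr_ge0 // ltW]; lra.
Qed.

Lemma possemidef_comb n (M N : 'M[R]_n) s t : 0 <= s -> 0 <= t ->
  possemidef M -> possemidef N -> possemidef (s *: M + t *: N).
Proof.
move=> s0 t0 pM pN; split; first by rewrite linearD !linearZ /= pM.1 pN.1.
by move=> v; rewrite qform_comb addr_ge0 // mulr_ge0 // ?pM.2 ?pN.2.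
Qed.

(* The variance [\sum_i a i * qform M (v i - m)] about the mean [m] is
   nonnegative. *)
Lemma qform_jensen n (M : 'M[R]_n) (I : finType) (a : I -> R)
    (v : I -> 'cV[R]_n) r :
  possemidef M -> (forall i, 0 <= a i) -> \sum_i a i = 1 ->
  (forall i, qform M (v i) <= r) -> qform M (\sum_i a i *: v i) <= r.
Proof.
move=> [sM pM] a0 a1 vr; set m := \sum_i _.
have : 0 <= \sum_i a i * qform M (v i - m).
  by apply: sumr_ge0 => i _; rewrite mulr_ge0.
have -> : \sum_i a i * qform M (v i - m) =
          \sum_i a i * qform M (v i) - qform M m.
  under eq_bigr => i _.
    rewrite qformD // -scaleN1r bformZr qformZ.
    have -> : a i * (qform M (v i) + 2 * (-1 * bform M (v i) m) +
      (-1) ^+ 2 * qform M m) = a i * qform M (v i)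
      + (-2 * (bform M (a i *: v i) m) + a i * qform M m).
      by rewrite bformZl; ring.
    over.
  rewrite big_split big_split /= -mulr_sumr -bform_suml -mulr_suml a1 -/m.
  rewrite /qform /bform; ring.
rewrite subr_ge0 => /le_trans; apply.
rewrite -[leRHS]mul1r -a1 mulr_suml; apply: ler_sum => i _.
exact: ler_wpM2l.
Qed.

Lemma possemidef1 n : possemidef (1%:M : 'M[R]_n).
Proof.
split=> [|v]; first exact: trmx1.
rewrite /qform -/(bform _ _ _) bformE; apply: sumr_ge0 => i _.
by rewrite -expr2 sqr_ge0.
Qed.

Lemma posdef1 n : posdef (1%:M : 'M[R]_n).
Proof.
split=> [|v v0]; first exact: trmx1.
rewrite lt_neqAle (possemidef1 n).2 andbT eq_sym; apply: contraNneq v0.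
rewrite /qform -/(bform _ _ _) bformE => /psumr_eq0P h.
apply/eqP/matrixP => i j; rewrite ord1 mxE; apply/eqP.
rewrite -sqrf_eq0 expr2 h // => k _; by rewrite -expr2 sqr_ge0.
Qed.

Lemma enorm_ge0 n (v : 'cV[R]_n) : 0 <= enorm v.
Proof. exact: sqrtr_ge0. Qed.

Lemma enorm_sqr n (v : 'cV[R]_n) : enorm v ^+ 2 = qform 1%:M v.
Proof.
rewrite /enorm sqr_sqrtr; last by apply: sumr_ge0 => i _; exact: sqr_ge0.
by rewrite /qform -/(bform _ _ _) bformE; apply: eq_bigr => i _; rewrite expr2.
Qed.

Lemma enorm_le1 n (v : 'cV[R]_n) : (enorm v <= 1) = (qform 1%:M v <= 1).
Proof. by rewrite -enorm_sqr expr_le1 // enorm_ge0. Qed.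

Lemma qform1_col_mx m n (u : 'cV[R]_m) (v : 'cV[R]_n) :
  qform 1%:M (col_mx u v) = qform 1%:M u + qform 1%:M v.
Proof. by rewrite /qform !mulmx1 tr_col_mx mul_row_col mxE. Qed.

Lemma enormZ n a (v : 'cV[R]_n) : 0 <= a -> enorm (a *: v) = a * enorm v.
Proof.
move=> a0; apply/eqP; rewrite -(eqrXn2 (ltn0Sn 1)) ?mulr_ge0 ?enorm_ge0 //.
by rewrite exprMn !enorm_sqr qformZ.
Qed.

(** For nonzero vectors, the squared norm of [enorm v *: u - enorm u *: v] is nonnegative and
    factors as [2 |u| |v| (|u| |v| - <u,v>)]. *)
Lemma cauchy_schwarz n (u v : 'cV[R]_n) :
  bform 1%:M u v <= enorm u * enorm v.
Proof.
have [v0|v0] := eqVneq v 0.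
  by rewrite v0 [X in X <= _](_ : _ = 0) ?mulr_ge0 ?enorm_ge0 //
    /bform mulmx0 mxE.
have [u0|u0] := eqVneq u 0.
  by rewrite u0 [X in X <= _](_ : _ = 0) ?mulr_ge0 ?enorm_ge0 //
    /bform trmx0 !mul0mx mxE.
have pos k (w : 'cV[R]_k) : w != 0 -> 0 < enorm w.
  move=> w0; rewrite lt_neqAle enorm_ge0 andbT eq_sym -sqrf_eq0 enorm_sqr.
  by rewrite gt_eqF // (posdef1 _).2.
have := (possemidef1 n).2 (enorm v *: u + (- enorm u) *: v).
rewrite qformD ?trmx1 // !qformZ -!enorm_sqr bformZl bformZr.
have := mulr_gt0 (pos _ _ u0) (pos _ _ v0); set e := enorm u; set h := enorm v.
move=> eh; have -> : h ^+ 2 * e ^+ 2 + 2 * (h * (- e * bform 1%:M u v)) +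
  (- e) ^+ 2 * h ^+ 2 = (2 * (e * h)) * (e * h - bform 1%:M u v) by ring.
by rewrite pmulr_rge0 ?subr_ge0 // mulr_gt0.
Qed.

Lemma cauchy_schwarz_norm n (u v : 'cV[R]_n) :
  `|bform 1%:M u v| <= enorm u * enorm v.
Proof.
rewrite ler_norml cauchy_schwarz andbT lerNl.
rewrite -mulN1r -bformZl scaleN1r; apply: le_trans (cauchy_schwarz _ _) _.
suff -> : enorm (- u) = enorm u by [].
by rewrite /enorm; congr Num.sqrt; apply: eq_bigr => i _; rewrite mxE sqrrN.
Qed.

(** Averages one summand while the rest is frozen in [x]; applied twice, it treats a sum of two
    convex hulls. *)
Lemma qform_jensen_shift n (M : 'M[R]_n) (I : finType) (a : I -> R) x
    (v : I -> 'cV[R]_n) r :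
  possemidef M -> (forall i, 0 <= a i) -> \sum_i a i = 1 ->
  (forall i, qform M (x + v i) <= r) -> qform M (x + \sum_i a i *: v i) <= r.
Proof.
move=> pM a0 a1 vr.
have -> : x + \sum_i a i *: v i = \sum_i a i *: (x + v i).
  under [RHS]eq_bigr do rewrite scalerDr.
  by rewrite big_split /= -scaler_suml a1 scale1r.
exact: qform_jensen.
Qed.

End Forms.

(** * Linear matrix inequalities *)

Section Lmi.
Variable R : realType.

Lemma qform_block_mx m n (A : 'M[R]_m) (B : 'M[R]_(m, n)) (D : 'M[R]_n) u v :
  qform (block_mx A B B^T D) (col_mx u v) =
  qform A u + 2 * bform B u v + qform D v.
Proof.
have addE (K N : 'M[R]_1) : (K + N) 0 0 = K 0 0 + N 0 0 by rewrite mxE.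
rewrite /qform tr_col_mx mul_row_block mul_row_col !mulmxDl !addE.
have -> : (v^T *m B^T *m u) 0 0 = bform B u v by rewrite [RHS]bform_tr.
rewrite -[(u^T *m B *m v) 0 0]/(bform B u v); ring.
Qed.

Lemma qform_scalar_mx n a (v : 'cV[R]_n) : qform a%:M v = a * qform 1%:M v.
Proof. by rewrite -(scalemx1 n a) /qform -scalemxAr -scalemxAl mxE. Qed.

(* Evaluate the quadratic form at [(y, 1, - P d)], i.e., take a Schur
   complement with respect to the last block. *)
Lemma lmi_mx_bound n m (a b : R) (G : 'M[R]_(n, m)) (v : 'rV[R]_m)
    (P : 'M[R]_m) (y : 'cV[R]_n) :
  posdef P -> possemidef (lmi_mx a b G v (invmx P)) ->
  qform P (G^T *m y + v^T) <= a * qform 1%:M y + b.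
Proof.
move=> pP [_ pL]; set d := _ + _.
have uP := posdef_unitmx pP.
have := pL (col_mx (col_mx y 1%:M) (- (P *m d))).
rewrite /lmi_mx -tr_col_mx qform_block_mx.
have -> : block_mx a%:M 0 0 b%:M = block_mx a%:M 0 0^T b%:M :> 'M[R]_(n + 1).
  by rewrite trmx0.
rewrite qform_block_mx (qform_scalar_mx a) (qform_scalar_mx b).
have -> : qform 1%:M (1%:M : 'cV[R]_1) = 1.
  by rewrite /qform trmx1 !mulmx1 mxE.
have -> : bform (0 : 'M[R]_(n, 1)) y 1%:M = 0.
  by rewrite /bform mulmx0 mul0mx mxE.
have -> : bform (col_mx G v) (col_mx y 1%:M) (- (P *m d)) = - qform P d.
  rewrite /bform /qform tr_col_mx mul_row_col trmx1 mul1mx.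
  rewrite [d^T]linearD /= trmx_mul !trmxK.
  by rewrite mulmxN mulmxA mxE.
have -> : qform (invmx P) (- (P *m d)) = qform P d.
  rewrite -scaleN1r qformZ sqrrN expr1n mul1r -qform_mul pP.1.
  by rewrite mulmxV // mul1mx.
lra.
Qed.

(** Testing at [(- L y, y)] leaves [dX |y|^2 - |L y|^2]. *)
Lemma block_mx_bound n (L : 'M[R]_n) (dX : R) (y : 'cV[R]_n) :
  possemidef (block_mx 1%:M L L^T dX%:M) ->
  qform 1%:M (L *m y) <= dX * qform 1%:M y.
Proof.
move=> [_ pL]; have := pL (col_mx (- (L *m y)) y).
rewrite qform_block_mx qform_scalar_mx -scaleN1r qformZ bformZl.
have -> : bform L (L *m y) y = qform 1%:M (L *m y).
  by rewrite /bform /qform mulmx1 mulmxA.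
rewrite sqrrN expr1n; lra.
Qed.

(** The last block is common to both matrices, and [s + t = 1] reproduces it. *)
Lemma lmi_mx_comb n m s t (a1 b1 a2 b2 : R) (G1 G2 : 'M[R]_(n, m))
    (v1 v2 : 'rV[R]_m) (M : 'M[R]_m) : s + t = 1 ->
  lmi_mx (s * a1 + t * a2) (s * b1 + t * b2) (s *: G1 + t *: G2)
    (s *: v1 + t *: v2) M =
  s *: lmi_mx a1 b1 G1 v1 M + t *: lmi_mx a2 b2 G2 v2 M.
Proof.
move=> st1; rewrite /lmi_mx !scale_block_mx !add_block_mx.
rewrite !scale_scalar_mx !scaler0 !addr0 -!raddfD /= -scalerDl st1 scale1r.
rewrite !scale_col_mx add_col_mx !scale_row_mx add_row_mx.
by rewrite !linearD /= !linearZ.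
Qed.

End Lmi.

(** * Points of a box as convex combinations of its vertices *)

Section Box.
Variables (R : realType) (n : nat).

(* Choosing the signs independently, the [i]-th being negative with probability
   [(1 - e i / h i) / 2], makes [e] the mean of the random vertex. *)
Lemma box_vertex_hull (h e : 'cV[R]_n) : (forall i, `|e i 0| <= h i 0) ->
  exists a : {ffun 'I_n -> bool} -> R,
  [/\ forall s, 0 <= a s, \sum_s a s = 1 & e = \sum_s a s *: box_vertex h s].
Proof.
move=> eh.
pose p i (b : bool) := (1 + (-1) ^+ b * (e i 0 / h i 0)) / 2 : R.
have p1 i : \sum_(b : bool) p i b = 1.
  rewrite big_bool /p /= expr0 expr1; lra.
have pe i : \sum_(b : bool) p i b * (-1) ^+ b * h i 0 = e i 0.
  rewrite big_bool /p /= expr0 expr1.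
  (* For a zero half-width the quotient is 0 by convention, both signs have probability 1/2, and
     [e i 0 = 0] is forced. *)
  have [h0|h0] := eqVneq (h i 0) 0; last by field.
  have := eh i; rewrite h0 normr_le0 => /eqP ->; ring.
have p0 i b : 0 <= p i b.
  have h0 : 0 <= h i 0 := le_trans (normr_ge0 _) (eh i).
  have : `|e i 0 / h i 0| <= 1.
    have [->|hn] := eqVneq (h i 0) 0; first by rewrite invr0 mulr0 normr0.
    rewrite normrM normfV [`|h i 0|]ger0_norm // ler_pdivrMr ?mul1r //.
    by rewrite lt_neqAle eq_sym hn.
  rewrite ler_norml => /andP[? ?]; rewrite /p.
  by case: b; rewrite /= ?expr0 ?expr1; lra.
exists (fun s => \prod_i p i (s i)); split.
- by move=> s; apply: prodr_ge0.
- rewrite -bigA_distr_bigA /=; under eq_bigr do rewrite p1.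
  by rewrite big1.
- apply/matrixP => i j; rewrite ord1 {j} summxE.
  under eq_bigr => s _ do rewrite !mxE.
  (* The value of the vertex is attached to coordinate [i] alone; every other factor of the product
     of sums is a total probability, i.e., 1. *)
  pose q k (b : bool) := p k b * (if k == i then (-1) ^+ b * h i 0 else 1).
  have <- : \prod_k \sum_(b : bool) q k b = e i 0.
    have qi : \sum_(b : bool) q i b = e i 0.
      by rewrite -[RHS]pe; apply: eq_bigr => b _; rewrite /q eqxx mulrA.
    rewrite (bigD1 i) //= qi big1 ?mulr1 // => k /negPf ki.
    by rewrite -[RHS](p1 k); apply: eq_bigr => b _; rewrite /q ki mulr1.
  rewrite bigA_distr_bigA; apply: eq_bigr => s _; rewrite big_split /=.
  congr (_ * _); rewrite (bigD1 i) //= eqxx big1 ?mulr1 // => k /negPf ->.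
  by [].
Qed.

End Box.

(** * Concavity of the logarithm of the determinant *)

Section LogDet.
Variable R : realType.

Definition schur n (M : 'M[R]_(1 + n)) : 'M[R]_n :=
  drsubmx M - (M 0 0)^-1 *: (dlsubmx M *m ursubmx M).

Lemma ulsubmx_scalar n (M : 'M[R]_(1 + n)) : ulsubmx M = (M 0 0)%:M.
Proof.
by rewrite [LHS]mx11_scalar !mxE; congr (M _ _)%:M; exact/val_inj.
Qed.

Lemma det_schur n (M : 'M[R]_(1 + n)) : M 0 0 != 0 ->
  \det M = M 0 0 * \det (schur M).
Proof.
move=> a0; rewrite -[in LHS](submxK M) ulsubmx_scalar.
(* Block LU factorization: one elimination step with pivot [M 0 0]. *)
have -> : block_mx (M 0 0)%:M (ursubmx M) (dlsubmx M) (drsubmx M) =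
    block_mx 1%:M 0 ((M 0 0)^-1 *: dlsubmx M) 1%:M *m
    block_mx (M 0 0)%:M (ursubmx M) 0 (schur M).
  rewrite mulmx_block !mul1mx !mul0mx !addr0 /schur.
  by rewrite mul_mx_scalar scalerA divff // scale1r -scalemxAl addrC subrK.
by rewrite det_mulmx det_lblock det_ublock !det1 !mul1r det_scalar expr1.
Qed.

(* Minimizing the quadratic form of [M] over its first coordinate [z] gives
   the quadratic form of the Schur complement. *)
Lemma qform_schur n (M : 'M[R]_(1 + n)) (z : 'cV[R]_1) v :
  M^T = M -> M 0 0 != 0 ->
  qform M (col_mx z v) =
  M 0 0 * (z 0 0 + (M 0 0)^-1 * (ursubmx M *m v) 0 0) ^+ 2 + qform (schur M) v.
Proof.
move=> sM a0; rewrite -[in LHS](submxK M) ulsubmx_scalar.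
have dl : dlsubmx M = (ursubmx M)^T by rewrite trmx_ursub sM.
rewrite dl qform_block_mx qform_scalar_mx /schur dl.
rewrite -scaleN1r scalerA -[drsubmx M in RHS]scale1r qform_comb.
have -> : qform ((ursubmx M)^T *m ursubmx M) v = (ursubmx M *m v) 0 0 ^+ 2.
  have := qform_mul 1%:M (ursubmx M) v; rewrite mulmx1 => ->.
  by rewrite /qform mulmx1 mxE big_ord1 mxE expr2.
have -> : bform (ursubmx M) z v = z 0 0 * (ursubmx M *m v) 0 0.
  by rewrite /bform -mulmxA mxE big_ord1 mxE.
have -> : qform 1%:M z = z 0 0 ^+ 2.
  by rewrite /qform mulmx1 mxE big_ord1 mxE expr2.
by field.
Qed.

(** This first coordinate makes the square in [qform_schur] vanish. *)
Lemma qform_schur_attained n (M : 'M[R]_(1 + n)) v :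
  M^T = M -> M 0 0 != 0 ->
  qform M (col_mx (- (M 0 0)^-1 *: (ursubmx M *m v)) v) = qform (schur M) v.
Proof.
move=> sM a0; rewrite qform_schur //.
set z := _ *m v; have -> : (- (M 0 0)^-1 *: z) 0 0 = - ((M 0 0)^-1 * z 0 0).
  by rewrite mxE mulNr.
by rewrite addNr expr0n mulr0 add0r.
Qed.

Lemma qform_corner n (M : 'M[R]_(1 + n)) :
  qform M (col_mx 1%:M 0) = M 0 0.
Proof.
rewrite -[M in LHS]submxK /qform tr_col_mx trmx0 trmx1 mul_row_block.
by rewrite !mul0mx !addr0 !mul1mx mul_row_col mulmx0 addr0 mulmx1
  ulsubmx_scalar mxE.
Qed.

Lemma posdef_corner n (M : 'M[R]_(1 + n)) : posdef M -> 0 < M 0 0.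
Proof.
move=> [_ pM]; rewrite -qform_corner; apply: pM.
apply/eqP => /(congr1 usubmx); rewrite col_mxKu linear0.
by move/matrixP => /(_ 0 0); rewrite !mxE; apply/eqP; exact: oner_neq0.
Qed.

Lemma posdef_schur n (M : 'M[R]_(1 + n)) : posdef M -> posdef (schur M).
Proof.
move=> pM; have a0 := posdef_corner pM; have [sM qM] := pM.
have dl : dlsubmx M = (ursubmx M)^T by rewrite trmx_ursub sM.
split.
  rewrite /schur linearB linearZ /= trmx_mul dl trmxK.
  by rewrite trmx_drsub sM.
move=> v v0.
have := qM (col_mx (- (M 0 0)^-1 *: (ursubmx M *m v)) v).
rewrite qform_schur_attained ?gt_eqF //; apply.
apply: contra_neq v0 => /(congr1 dsubmx).
by rewrite col_mxKd linear0.
Qed.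

Lemma posdef_det_gt0 n (M : 'M[R]_n) : posdef M -> 0 < \det M.
Proof.
elim: n M => [|n IHn] M pM; first by rewrite det_mx00.
have a0 := @posdef_corner n M pM.
rewrite (@det_schur n M) ?gt_eqF // mulr_gt0 //.
exact/IHn/(@posdef_schur n M).
Qed.

(* The statement compares with an arbitrary [Z] above [s *: X + t *: Y]
   because the Schur complement is only superadditive: that is the form in
   which the induction goes through. *)
Lemma ln_det_superconcave n (X Y Z : 'M[R]_n) (s t : R) :
  0 <= s -> 0 <= t -> s + t = 1 -> posdef X -> posdef Y -> posdef Z ->
  (forall v, s * qform X v + t * qform Y v <= qform Z v) ->
  s * ln (\det X) + t * ln (\det Y) <= ln (\det Z).
Proof.
move=> s0 t0 st1.
elim: n X Y Z => [|n IHn] X Y Z pX pY pZ XYZ.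
  by rewrite !det_mx00 ln1 !mulr0 addr0.
have aX := @posdef_corner n X pX; have aY := @posdef_corner n Y pY.
have aZ := @posdef_corner n Z pZ.
have bX := @posdef_schur n X pX; have bY := @posdef_schur n Y pY.
have bZ := @posdef_schur n Z pZ.
rewrite (@det_schur n X) ?gt_eqF // (@det_schur n Y) ?gt_eqF //.
rewrite (@det_schur n Z) ?gt_eqF //.
rewrite !lnM ?posrE //; try exact: posdef_det_gt0.
(* Pivots: concavity of the scalar logarithm, then the comparison of the forms at the first basis
   vector. *)
have h1 : s * ln (X 0 0) + t * ln (Y 0 0) <= ln (Z 0 0).
  have s1 : s <= 1 by lra.
  have t1 : t = 1 - s by lra.
  have h : s * ln (X 0 0) + t * ln (Y 0 0) <= ln (s * X 0 0 + t * Y 0 0).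
    by rewrite t1; exact: (concave_ln (Itv01 s0 s1)).
  have hp : 0 < s * X 0 0 + t * Y 0 0.
    by rewrite t1; exact: (convR_gt0 (Itv01 s0 s1)).
  apply: (le_trans h); rewrite ler_ln //.
  have := XYZ (col_mx (1%:M : 'cV_1) (0 : 'cV_n)).
  by rewrite !(@qform_corner n).
have h2 : s * ln (\det (@schur n X)) + t * ln (\det (@schur n Y)) <=
          ln (\det (@schur n Z)).
  apply: IHn => // v.
  (* [z] is the minimizer for [Z]: the right side becomes the form of its Schur complement, while
     the left side only decreases when the squares for [X] and [Y] are dropped. *)
  pose z : 'cV[R]_1 := - (Z 0 0)^-1 *: (ursubmx (Z : 'M[R]_(1 + n)) *m v).
  have := XYZ (col_mx z (v : 'cV_n)).
  rewrite (@qform_schur_attained n Z) ?gt_eqF ?pZ.1 //.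
  rewrite (@qform_schur n X) ?gt_eqF ?pX.1 //.
  rewrite (@qform_schur n Y) ?gt_eqF ?pY.1 //.
  apply: le_trans; apply: lerD; apply: ler_wpM2l => //;
    by rewrite lerDr mulr_ge0 ?sqr_ge0 // ltW.
lra.
Qed.

End LogDet.

(** * The linearization error *)

Section Taylor.
Variables (R : realType) (nx nu nw : nat).
Notation point := ('cV[R]_nx * 'cV[R]_nu * 'cV[R]_nw)%type.
Variable f : point -> 'cV[R]_nx.

Lemma stackB (p q : point) : stack (p - q) = stack p - stack q.
Proof. by rewrite /stack /= !opp_col_mx !add_col_mx. Qed.

Lemma enorm_stack (p : point) : enorm (stack p) ^+ 2 =
  enorm p.1.1 ^+ 2 + enorm p.1.2 ^+ 2 + enorm p.2 ^+ 2.
Proof. by rewrite !enorm_sqr !qform1_col_mx. Qed.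

Lemma cV_delta_sum n (v : 'cV[R]_n) : v = \sum_j v j 0 *: delta_mx j 0.
Proof.
by rewrite [LHS]matrix_sum_delta; apply: eq_bigr => i _; rewrite big_ord1.
Qed.

(** Gives linearity facts for a bare function with a proof of [linear], such as the embeddings
    [x |-> (x, 0, 0)]. *)
Lemma linear_cVE n (V : lmodType R) (g : 'cV[R]_n -> V) : linear g ->
  [/\ g 0 = 0, forall h v, g (h *: v) = h *: g v &
    forall v, g v = \sum_j v j 0 *: g (delta_mx j 0)].
Proof.
move=> g_lin; pose gM := GRing.isLinear.Build _ _ _ _ _ g_lin.
pose gL : {linear _ -> _} := HB.pack g gM.
have gZ h v : g (h *: v) = h *: g v := linearZ_LR gL h v.
split; [exact: (linear0 gL)| exact: gZ |move=> v].
have -> : g v = gL (\sum_j v j 0 *: delta_mx j 0) by rewrite -cV_delta_sum.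
by rewrite linear_sum; apply: eq_bigr => k _; exact: gZ.
Qed.

(** [F] is [f] along the affine slice through [p], so its difference quotients in direction [v] are
    those of [f] in direction [inj v]. Serves the state, input and disturbance blocks alike. *)
Lemma jac_mulE n (inj : 'cV[R]_n -> point) (F : 'cV[R]_n -> 'cV[R]_nx)
    (a d : 'cV[R]_n) (p : point) :
  linear inj -> (forall x, F x = f (inj (x - a) + p)) ->
  differentiable f p -> jac F a *m d = 'd f p (inj d).
Proof.
move=> inj_lin Ff df.
have [inj0 injZ injE] := linear_cVE inj_lin.
have D v : 'D_v F a = 'd f p (inj v).
  rewrite -deriveE // /derive.
  suff -> : (fun h : R => h^-1 *: ((F \o shift a) (h *: v) - F a)) =
    (fun h : R => h^-1 *: ((f \o shift p) (h *: inj v) - f p)) by [].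
  by apply/funext => h /=; rewrite !Ff /= addrK subrr inj0 add0r injZ.
rewrite injE linear_sum; apply/matrixP => i j.
rewrite ord1 mxE summxE; apply: eq_bigr => k _.
by rewrite linearZ /= !mxE D mulrC.
Qed.

Lemma diff_jac (p d : point) : differentiable f p ->
  'd f p d = jac_x f p *m d.1.1 + jac_u f p *m d.1.2 + jac_w f p *m d.2.
Proof.
move=> df.
have e n a : a *: (0 : 'cV[R]_n) + 0 = 0 by rewrite scaler0 addr0.
have lx : linear (fun x : 'cV[R]_nx => (x, 0, 0) : point).
  by move=> a x y;
    transitivity ((a *: x + y, a *: 0 + 0, a *: 0 + 0) : point);
    [rewrite !e|].
have lu : linear (fun u : 'cV[R]_nu => (0, u, 0) : point).
  by move=> a x y;
    transitivity ((a *: 0 + 0, a *: x + y, a *: 0 + 0) : point);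
    [rewrite !e|].
have lw : linear (fun w : 'cV[R]_nw => (0, 0, w) : point).
  by move=> a x y;
    transitivity ((a *: 0 + 0, a *: 0 + 0, a *: x + y) : point);
    [rewrite !e|].
have addE (a b : point) :
  a + b = (a.1.1 + b.1.1, a.1.2 + b.1.2, a.2 + b.2) by [].
case: p df => [[x u] w] df.
rewrite /jac_x /jac_u /jac_w (jac_mulE _ lx _ df); last first.
  by move=> y; rewrite addE /= subrK !add0r.
rewrite (jac_mulE _ lu _ df); last first.
  by move=> y; rewrite addE /= subrK !add0r.
rewrite (jac_mulE _ lw _ df); last first.
  by move=> y; rewrite addE /= subrK !add0r.
rewrite -!linearD /=; congr ('d f _ _).
by case: d => [[? ?] ?]; rewrite !addE /= !addr0 !add0r.
Qed.

Lemma diff_grad (p d : point) i : differentiable f p ->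
  ('d f p d) i 0 = bform 1%:M (grad f i p) (stack d).
Proof.
move=> df; rewrite diff_jac // /bform mulmx1 trmxK /stack.
by rewrite -row_mul !mul_row_col [RHS]mxE.
Qed.

(** Along the segment, Cauchy-Schwarz bounds the deviation of the derivative from its initial value
    by [Lip |d|^2 t]; the factor 1/2 is the primitive of [t] at 1. *)
Lemma taylor_bound (Lip : R) (i : 'I_nx) (p d : point) :
  (forall t : R, 0 <= t <= 1 -> differentiable f (t *: d + p)) ->
  (forall t : R, 0 <= t <= 1 ->
    enorm (grad f i (t *: d + p) - grad f i p)
      <= Lip * enorm (stack (t *: d + p) - stack p)) ->
  `|(f (d + p) - f p - 'd f p d) i 0| <= 2^-1 * Lip * enorm (stack d) ^+ 2.
Proof.
move=> df lipf.
pose phi (t : R) : R := f (t *: d + p) i 0.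
pose k : R := ('d f p d) i 0; pose e : R := enorm (stack d) ^+ 2.
have dphi (t : R) : 0 <= t <= 1 ->
    is_derive t 1 phi (('d f (t *: d + p) d) i 0).
  move=> t01; have dft := df _ t01; have Dft := diff_derivable (v := d) dft.
  have E : (fun h : R => h^-1 *: ((phi \o shift t) (h *: (1 : R)) - phi t)) =
    (fun h : R => h^-1 *: (((fun x => f x i 0) \o shift (t *: d + p)) (h *: d)
       - f (t *: d + p) i 0)).
    by apply/funext => h; rewrite /phi /= /shift scalerDl addrA -scalerA
      scale1r.
  split.
    by rewrite /derivable E; exact: (derivable_mxP _ _ _).1.
  by rewrite /derive E -(deriveE _ dft) derive_mx // mxE.
have stack_seg (t : R) : stack (t *: d + p) - stack p = t *: stack d.
  by rewrite -stackB addrK /stack /= !scale_col_mx.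
have dphi_le (t : R) : 0 <= t <= 1 ->
    `|('d f (t *: d + p) d) i 0 - k| <= Lip * e * t.
  move=> t01; have [t0 _] := andP t01.
  have dfp : differentiable f p.
    by rewrite -[p]add0r -(scale0r d); apply: df; rewrite lexx ler01.
  have -> : 'd f (t *: d + p) d i 0 - k =
      bform 1%:M (grad f i (t *: d + p) - grad f i p) (stack d).
    rewrite bformBl /k.
    by congr (_ - _); [exact: (diff_grad d i (df t t01)) |
      exact: (diff_grad d i dfp)].
  apply: le_trans (cauchy_schwarz_norm _ _) _.
  have := lipf t t01; rewrite stack_seg enormZ // => h.
  apply: le_trans (ler_wpM2r (enorm_ge0 _) h) _.
  by rewrite /e le_eqVlt; apply/orP; left; apply/eqP; ring.
have bound b : (-1) ^+ (b : bool) * (f (d + p) - f p - 'd f p d) i 0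
    <= 2^-1 * Lip * e.
  (* The subtracted square is the primitive of the derivative bound, so [psi] is nonincreasing, and
     [psi 1 <= psi 0] is the claim. The sign [b] yields both halves of the absolute value. *)
  pose psi : R -> R := (-1) ^+ b *: (phi - k *: (@id R))
    - (2^-1 * Lip * e) *: ((@id R) ^+ 2).
  have psiE (t : R) :
    psi t = (-1) ^+ b * (phi t - k * t) - 2^-1 * Lip * e * t ^+ 2 by [].
  have dpsi (t : R) : 0 <= t <= 1 -> is_derive t 1 psi
      ((-1) ^+ b * (('d f (t *: d + p) d) i 0 - k) - Lip * e * t).
    move=> t01; have ? := dphi _ t01; apply: is_derive_eq.
    by rewrite /GRing.scale /=; field.
  have in01 (t : R) : t \in `]0, 1[%R -> 0 <= t <= 1.
    by rewrite in_itv /= => /andP[? ?]; rewrite !ltW.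
  have psi10 : psi 1 <= psi 0.
    apply: (@ler0_derive1_le_cc R psi 0 1) => //.
    - by move=> t /in01 /dpsi [].
    - move=> t /in01 t01; rewrite derive1E; have [_ ->] := dpsi _ t01.
      rewrite subr_le0; apply: le_trans (dphi_le _ t01).
      by rewrite -[leRHS](normrMsign b) ler_norm.
    - apply: continuous_in_subspaceT => t; rewrite inE /= in_itv /= => t01.
      apply: differentiable_continuous; apply/derivable1_diffP.
      by have [] := dpsi _ t01.
    - by rewrite in_itv /= ler01 lexx.
    - by rewrite in_itv /= ler01 lexx.
  have -> : (f (d + p) - f p - 'd f p d) i 0 = phi 1 - k - phi 0.
    by rewrite /phi scale0r add0r scale1r !mxE -/k; ring.
  by move: psi10; rewrite !psiE; lra.
rewrite ler_norml lerNl -/e.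
by have := bound true; have := bound false;
  rewrite expr0 mul1r expr1 mulN1r => -> ->.
Qed.

End Taylor.

(** * The worst-case stage cost *)

Section Maximum.
Variable R : realType.

Lemma continuous_sumR (T : topologicalType) (I : finType) (g : I -> T -> R) :
  (forall i, continuous (g i)) -> continuous (fun x => \sum_i g i x).
Proof.
by move=> cg; apply: continuous_big => // x; exact: add_continuous.
Qed.

(** Row vectors are the type on which [bounded_closed_compact] and [EVT_max_rV] are applied below,
    hence the transpose. *)
Lemma continuous_qform_affine m n (M : 'M[R]_m) (N : 'M[R]_(m, n)) b :
  continuous (fun r : 'rV[R]_n => qform M (N *m r^T + b)).
Proof.
have cc k : continuous (fun r : 'rV[R]_n => (N *m r^T + b) k 0).
  rewrite (_ : (fun _ => _) =
    (fun r : 'rV[R]_n => \sum_j N k j * r 0 j + b k 0)); last first.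
    by apply/funext => r; rewrite !mxE; congr (_ + _); apply: eq_bigr => j _;
      rewrite !mxE.
  move=> r; apply: continuousD; last exact: cst_continuous.
  apply: continuous_sumR => j {}r.
  by apply: continuousM; [exact: cst_continuous | exact: coord_continuous].
rewrite (_ : (fun _ => _) = (fun r : 'rV[R]_n =>
  \sum_j (\sum_i (N *m r^T + b) i 0 * M i j) * (N *m r^T + b) j 0)); last first.
  apply/funext => r; rewrite /qform mxE; apply: eq_bigr => j _; congr (_ * _).
  by rewrite mxE; apply: eq_bigr => i _; rewrite [_^T _ _]mxE.
apply: continuous_sumR => j r; apply: continuousM; last exact: cc.
apply: continuous_sumR => i {}r.
by apply: continuousM; [exact: cc | exact: cst_continuous].
Qed.

Lemma compact_unit_ball n : compact [set r : 'rV[R]_n | qform 1%:M r^T <= 1].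
Proof.
apply: bounded_closed_compact.
  exists 1; split => // K K1 r /= r1; apply/ltW/(le_lt_trans _ K1).
  (* The norm here is the sup norm: each squared coordinate is at most the sum of squares. *)
  rewrite [leLHS]/Num.Def.normr/= mx_normrE (bigmax_le _ ler01) //=.
  move=> -[i j] _ /=.
  rewrite ord1 -(@expr_le1 _ 2) // real_normK ?num_real //.
  apply: le_trans r1; rewrite /qform -/(bform _ _ _) bformE (bigD1 j) //=.
  rewrite !mxE -expr2 lerDl; apply: sumr_ge0 => k _.
  by rewrite -expr2 sqr_ge0.
have -> : [set r : 'rV[R]_n | qform 1%:M r^T <= 1] =
    (fun r => qform 1%:M (1%:M *m r^T + 0)) @^-1` [set x | x <= 1].
  by apply/seteqP; split=> r /=; rewrite mul1mx addr0.
apply: closed_comp => // r _; exact: continuous_qform_affine.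
Qed.

(** By symmetry of [L], [L^T L^-2 L = I], so [x = L y + c] turns the form of the ellipsoid into
    [|y|^2]. *)
Lemma ellipsoidP n (L : 'M[R]_n) c : posdef L ->
  ellipsoid c (invmx (L *m L)) =
  [set L *m y + c | y in [set y | qform 1%:M y <= 1]].
Proof.
move=> pL; have uL := posdef_unitmx pL.
have LL : L^T *m invmx (L *m L) *m L = 1%:M.
  rewrite pL.1; apply: (can_inj (mulKmx uL)); rewrite !mulmxA mulmx1.
  by rewrite mulmxV ?mul1mx // unitmx_mul uL.
apply/seteqP; split=> x /=.
  move=> h; exists (invmx L *m (x - c)); last by rewrite mulKVmx // subrK.
  by rewrite -LL qform_mul mulKVmx.
by move=> [y y1 <-]; rewrite /ellipsoid /= addrK -qform_mul LL.
Qed.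

(** In the coordinate [y], where the control is [F y + l], the cost is a quadratic form of an affine
    map, hence continuous on the compact unit ball. *)
Lemma stage_cost_max nx nu (Q : 'M[R]_(nx + nu + 1)) (L : 'M[R]_nx)
    (F : 'M[R]_(nu, nx)) c l : posdef L ->
  exists m, is_maximum [set stage_cost Q x (ctrl (F *m invmx L) c l x)
    | x in ellipsoid c (invmx (L *m L))] m.
Proof.
move=> pL; have uL := posdef_unitmx pL.
pose h (r : 'rV[R]_nx) := qform Q (col_mx (col_mx L F) 0 *m r^T
  + col_mx (col_mx c l) 1%:M).
have hE y : stage_cost Q (L *m y + c) (ctrl (F *m invmx L) c l (L *m y + c))
    = h y^T.
  rewrite /h trmxK !mul_col_mx !add_col_mx mul0mx add0r /stage_cost /ctrl.
  by rewrite addrK mulmxA mulmxKV.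
have B0 : [set r : 'rV[R]_nx | qform 1%:M r^T <= 1] !=set0.
  by exists 0; rewrite /= /qform trmx0 mulmx0 mxE ler01.
have [r /set_mem r1 rmax] := EVT_max_rV B0 (@compact_unit_ball nx)
  (continuous_subspaceT (@continuous_qform_affine _ _ Q _ _) :
    {within _, continuous h}).
exists (h r); rewrite (ellipsoidP _ pL); split.
  by exists (L *m r^T + c); [exists r^T | rewrite hE trmxK].
move=> _ [_ [y y1 <-] <-]; rewrite hE; apply: rmax.
by rewrite inE /= trmxK.
Qed.

End Maximum.

(** * Convexity of the program *)

Section Hulls.
Variable R : realType.

(** S-procedure: the multiplier [a >= 0] is paired with [|y|^2 <= 1], so that
    [a |y|^2 + (r - a) <= r]. *)
Lemma lmi_mx_le n m (a r : R) (G : 'M[R]_(n, m)) (v : 'rV[R]_m)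
    (P : 'M[R]_m) (y : 'cV[R]_n) :
  posdef P -> 0 <= a -> qform 1%:M y <= 1 ->
  possemidef (lmi_mx a (r - a) G v (invmx P)) ->
  qform P (G^T *m y + v^T) <= r.
Proof.
move=> pP a0 y1 /(@lmi_mx_bound _ _ _ _ _ _ _ _ y pP) /le_trans; apply.
have := ler_wpM2l a0 y1; lra.
Qed.

Lemma lmi_mx1_le n m (a r : R) (G : 'M[R]_(n, m)) (v : 'rV[R]_m)
    (y : 'cV[R]_n) :
  0 <= a -> qform 1%:M y <= 1 -> possemidef (lmi_mx a (r - a) G v 1%:M) ->
  qform 1%:M (G^T *m y + v^T) <= r.
Proof.
move=> a0 y1 h; apply: (lmi_mx_le (posdef1 R m) a0 y1).
by rewrite invmx1.
Qed.

(** With [input_set_convex], this keeps the segment from [pbar] inside the domain of the Lipschitz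
    bound. *)
Lemma conv_hull_convex n N (w : 'I_N -> 'cV[R]_n) x y (t : R) :
  0 <= t <= 1 -> conv_hull w x -> conv_hull w y ->
  conv_hull w (t *: x + (1 - t) *: y).
Proof.
move=> /andP[t0 t1] [a [a0 a1 ->]] [b [b0 b1 ->]].
exists (fun j => t * a j + (1 - t) * b j); split.
- by move=> j; rewrite addr_ge0 // mulr_ge0 // subr_ge0.
- by rewrite big_split /= -!mulr_sumr a1 b1 !mulr1 addrC subrK.
- rewrite !scaler_sumr -big_split /=; apply: eq_bigr => j _.
  by rewrite /= [RHS]scalerDl !scalerA.

Qed.

Lemma qform_convex n (M : 'M[R]_n) x y (t r : R) :
  possemidef M -> 0 <= t <= 1 ->
  qform M x <= r -> qform M y <= r -> qform M (t *: x + (1 - t) *: y) <= r.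
Proof.
move=> pM /andP[t0 t1] xr yr.
have := @qform_jensen R n M bool (fun b => if b then t else 1 - t)
  (fun b => if b then x else y) r pM.
rewrite !big_bool /=; apply.
- by case; rewrite ?subr_ge0.
- by rewrite addrC subrK.
- by case.
Qed.

Lemma input_set_convex nu Nu (mU : 'I_Nu -> nat)
    (Uk : forall k, 'M[R]_(mU k, nu)) x y (t : R) : 0 <= t <= 1 ->
  input_set Uk x -> input_set Uk y -> input_set Uk (t *: x + (1 - t) *: y).
Proof.
move=> t01 Ux Uy k _ /=; rewrite enorm_le1 mulmxDr -!scalemxAr.
by apply: qform_convex; rewrite -?enorm_le1; first [exact: possemidef1 |
  exact: t01 | exact: (Ux k I) | exact: (Uy k I)].
Qed.

(** For a fixed sign pattern the vertex is linear in the half-widths, so the target constraints are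
    affine in [dX] and [dU]. *)
Lemma box_vertexZ n a (h : 'cV[R]_n) s :
  box_vertex (a *: h) s = a *: box_vertex h s.
Proof. by apply/matrixP => i j; rewrite !mxE mulrCA. Qed.

End Hulls.

Section Convexity.
Variables (R : realType) (nx nu nw Nu Nw ns : nat) (mU : 'I_Nu -> nat).
Variables (A : 'M[R]_nx) (B : 'M[R]_(nx, nu)) (E : 'M[R]_(nx, nw)).
Variables (g Lip : 'cV[R]_nx) (Uk : forall k, 'M[R]_(mU k, nu)).
Variables (ws : 'I_Nw -> 'cV[R]_nw) (c : 'cV[R]_nx) (ubar : 'cV[R]_nu).
Variables (cp : 'cV[R]_nx) (Pp : 'M[R]_nx) (S : 'M[R]_(ns, nx + nu + 1)).

Let C := feasible A B E g Lip Uk ws c ubar cp Pp S.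

(** Separate equations for the four entries let each constraint be checked entry by entry. *)
Lemma lmi_mx_comb_psd n m s t (a1 b1 a2 b2 a b : R) (G1 G2 G : 'M[R]_(n, m))
    (v1 v2 v : 'rV[R]_m) (M : 'M[R]_m) : 0 <= s -> 0 <= t -> s + t = 1 ->
  a = s * a1 + t * a2 -> b = s * b1 + t * b2 -> G = s *: G1 + t *: G2 ->
  v = s *: v1 + t *: v2 ->
  possemidef (lmi_mx a1 b1 G1 v1 M) -> possemidef (lmi_mx a2 b2 G2 v2 M) ->
  possemidef (lmi_mx a b G v M).
Proof.
move=> s0 t0 st -> -> -> -> p1 p2; rewrite lmi_mx_comb //.
exact: possemidef_comb.
Qed.

Lemma feasible_comb (y1 y2 : dvar R nx nu Nu Nw) s t :
  0 <= s -> 0 <= t -> s + t = 1 -> C y1 -> C y2 -> C (s *: y1 + t *: y2).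
Proof.
move=> s0 t0 st.
move: y1 y2 => [[[[[[[[[L1 F1] l1] dX1] dU1] phi1] beta1] tau1] gam1] Jt1]
  [[[[[[[[[L2 F2] l2] dX2] dU2] phi2] beta2] tau2] gam2] Jt2].
move=> [[pL1 [X1 U1 ph1 ga1]] [[be1 ta1] [a1 b1 c1 d1 e1]]].
move=> [[pL2 [X2 U2 ph2 ga2]] [[be2 ta2] [a2 b2 c2 d2 e2]]].
have comb_ge0 (x y : R) : 0 <= x -> 0 <= y -> 0 <= s * x + t * y.
  by move=> x0 y0; rewrite addr_ge0 // mulr_ge0.
have s_ : s = 1 - t by lra.
have comb_cst m n (M : 'M[R]_(m, n)) : M = s *: M + t *: M.
  by rewrite -scalerDl st scale1r.
(* Operations of the product module compute componentwise. *)
change (C (s *: L1 + t *: L2, s *: F1 + t *: F2, s *: l1 + t *: l2,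
  s * dX1 + t * dX2, s * dU1 + t * dU2, s * phi1 + t * phi2,
  s *: beta1 + t *: beta2, s *: tau1 + t *: tau2, s * gam1 + t * gam2,
  s * Jt1 + t * Jt2)).
split; [split; [exact: posdef_comb | by split; exact: comb_ge0] | split].
- split; first by move=> ij; rewrite !ffunE; exact: comb_ge0.
  by move=> k; rewrite !ffunE; exact: comb_ge0.
- split.
  + have := possemidef_comb s0 t0 a1 a2.
    rewrite !scale_block_mx !add_block_mx -comb_cst !scale_scalar_mx.
    by rewrite -raddfD; rewrite [(_ + _)^T]linearD /= !linearZ.
  + apply: (lmi_mx_comb_psd s0 t0 st _ _ _ _ b1 b2) => //.
    * ring.
    * by rewrite linearD !linearZ.
    * by rewrite [ubar in LHS]comb_cst -!linearZ -linearD /= !scalerBr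
        opprD addrACA.
  + move=> i j; apply: (lmi_mx_comb_psd s0 t0 st _ _ _ _ (c1 i j) (c2 i j)).
    * by rewrite !ffunE.
    * by rewrite !ffunE /GRing.scale /= s_; ring.
    * by rewrite -!linearZ -linearD /= !mulmxDr -!scalemxAr !scalerDr addrACA.
    (* The constant terms [g], [A c], [cp], [E w_j] and the [dW] part of the vertex are reproduced
       because the weights are [1 - t] and [t]. *)
    * rewrite -!linearD -!linearZ -linearD /= !box_vertexZ; congr (_^T).
      rewrite mulmxDr -!scalemxAr /GRing.scale /= s_.
      apply/matrixP => p q; rewrite !mxE; ring.
  + move=> k; apply: (lmi_mx_comb_psd s0 t0 st _ _ _ _ (d1 k) (d2 k)).
    * by rewrite !ffunE.
    * by rewrite !ffunE /GRing.scale /= s_; ring.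
    * by rewrite linearD !linearZ /= mulmxDl -!scalemxAl.
    * by rewrite linearD !linearZ /= mulmxDl -!scalemxAl.
  + apply: (lmi_mx_comb_psd s0 t0 st _ _ _ _ e1 e2) => //.
    * ring.
    * rewrite !scalemxAl -mulmxDl; congr (_ *m _).
      by rewrite !scale_row_mx !add_row_mx !scaler0 addr0 linearD !linearZ.
    * rewrite !scalemxAl -mulmxDl; congr (_ *m _).
      by rewrite !scale_row_mx !add_row_mx -!comb_cst linearD !linearZ.
Qed.

Lemma feasible_convex : convex_set C.
Proof.
move=> y1 y2 t /set_mem C1 /set_mem C2; apply/mem_set.
by apply: feasible_comb => //; rewrite ?subr_ge0 // addrC subrK.
Qed.

Lemma objective_convex lam : 0 <= lam <= 1 -> convex_function C (objective lam).
Proof.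
move=> /andP[lam0 lam1] t y1 y2 /set_mem C1 /set_mem C2.
have s0 : 0 <= t%:num by [].
have u0 : 0 <= 1 - t%:num by rewrite subr_ge0.
move: y1 y2 C1 C2 => [[[[[[[[[L1 F1] l1] dX1] dU1] phi1] beta1] tau1] gam1] Jt1]
  [[[[[[[[[L2 F2] l2] dX2] dU2] phi2] beta2] tau2] gam2] Jt2].
move=> [[pL1 _] _] [[pL2 _] _].
have st : t%:num + (1 - t%:num) = 1 by rewrite addrC subrK.
have h : t%:num * ln (\det L1) + (1 - t%:num) * ln (\det L2) <=
    ln (\det (t%:num *: L1 + (1 - t%:num) *: L2)).
  (* [Z] is the convex combination itself, so the forms agree. *)
  apply: ln_det_superconcave => // [|v]; first exact: posdef_comb.
  by rewrite qform_comb.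
change (lam * (t%:num * Jt1 + (1 - t%:num) * Jt2)
  + (1 - lam) * - ln (\det (t%:num *: L1 + (1 - t%:num) *: L2)) <=
  t%:num * (lam * Jt1 + (1 - lam) * - ln (\det L1)) +
  (1 - t%:num) * (lam * Jt2 + (1 - lam) * - ln (\det L2))).
have lam0' : 0 <= 1 - lam by rewrite subr_ge0.
have := ler_wpM2l lam0' h; lra.
Qed.

End Convexity.

(** * Guarantees for a feasible point *)

Section Transition.
Variables (R : realType) (nx nu nw : nat).
Notation point := ('cV[R]_nx * 'cV[R]_nu * 'cV[R]_nw)%type.

Lemma linearization_bound (f : point -> 'cV[R]_nx) X U W Lip (p d : point) i :
  smooth_system f X U W Lip ->
  (forall t : R, 0 <= t <= 1 -> (X `*` U `*` W) (t *: d + p)) ->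
  `|(f (d + p) - f p - 'd f p d) i 0|
    <= 2^-1 * Lip i 0 * enorm (stack d) ^+ 2.
Proof.
move=> [_ _ df _ lipf] seg; apply: taylor_bound => t t01.
  exact/df/seg.
apply: lipf; first exact: seg.
by rewrite -[p]add0r -(scale0r d); apply: seg; rewrite lexx ler01.
Qed.

(* The remainder [e] lies in the box, and [(e, w)] in the convex hull of the
   pairs (vertex, generator) at which the constraint is imposed. *)
Lemma robust_ellipsoid Nw (P : 'M[R]_nx) (E : 'M[R]_(nx, nw))
    (ws : 'I_Nw -> 'cV[R]_nw) (b e h : 'cV[R]_nx) w r :
  possemidef P -> conv_hull ws w -> (forall i, `|e i 0| <= h i 0) ->
  (forall s j, qform P (b + box_vertex h s + E *m ws j) <= r) ->
  qform P (b + e + E *m w) <= r.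
Proof.
move=> pP [a [a0 a1 ->]] /box_vertex_hull [k [k0 k1 ->]] br.
have -> : E *m (\sum_j a j *: ws j) = \sum_j a j *: (E *m ws j).
  by rewrite mulmx_sumr; apply: eq_bigr => j _; rewrite -scalemxAr.
apply: qform_jensen_shift => // j; rewrite addrAC.
by apply: qform_jensen_shift => // s; rewrite addrAC.
Qed.

(** The squared norm is a convex quadratic form, so its bound at the generators passes to the
    hull. *)
Lemma conv_hull_enorm n N (w : 'I_N -> 'cV[R]_n) x : conv_hull w x ->
  enorm x ^+ 2 <= \big[Num.max/0]_(j < N) enorm (w j) ^+ 2.
Proof.
move=> [a [a0 a1 ->]]; rewrite enorm_sqr; apply: qform_jensen => //.
  exact: possemidef1.
move=> j; rewrite -enorm_sqr.
exact: (le_bigmax _ (fun j => enorm (w j) ^+ 2)).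
Qed.

End Transition.

(** * What each matrix inequality gives at the state [L y + c], for [y] in the unit ball *)

Section Guarantees.
Variables (R : realType) (nx nu nw Nu Nw ns : nat) (mU : 'I_Nu -> nat).
Variables (A : 'M[R]_nx) (B : 'M[R]_(nx, nu)) (E : 'M[R]_(nx, nw)).
Variables (g Lip : 'cV[R]_nx) (Uk : forall k, 'M[R]_(mU k, nu)).
Variables (ws : 'I_Nw -> 'cV[R]_nw) (c : 'cV[R]_nx) (ubar : 'cV[R]_nu).
Variables (cp : 'cV[R]_nx) (Pp : 'M[R]_nx) (S : 'M[R]_(ns, nx + nu + 1)).
Variables (L : 'M[R]_nx) (F : 'M[R]_(nu, nx)) (l : 'cV[R]_nu).
Variables (dX dU phi : R).
Variables (beta : {ffun {ffun 'I_nx -> bool} * 'I_Nw -> R^o}).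
Variables (tau : {ffun 'I_Nu -> R^o}) (gamma Jt : R).
Hypothesis feas : feasible A B E g Lip Uk ws c ubar cp Pp S
  (L, F, l, dX, dU, phi, beta, tau, gamma, Jt).

Variable y : 'cV[R]_nx.
Hypothesis y1 : qform 1%:M y <= 1.

Lemma feasible_input : input_set Uk (F *m y + l).
Proof.
case: feas => _ [[_ tau0] [_ _ _ lmi _]] k _ /=; rewrite enorm_le1.
have := lmi_mx1_le (tau0 k) y1 (lmi k).
by rewrite -!trmx_mul !trmxK -mulmxA -mulmxDr.
Qed.

Lemma feasible_cost :
  stage_cost (S^T *m S) (L *m y + c) (F *m y + l) <= Jt.
Proof.
case: feas => [[pL [_ _ _ gamma0]] [_ [_ _ _ _ lmi]]].
have := lmi_mx1_le gamma0 y1 lmi.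
rewrite !trmx_mul !trmxK !tr_row_mx !trmxK trmx0 trmx1 pL.1 -mulmxA -mulmxDr.
rewrite !mul_col_mx !add_col_mx mul0mx add0r /stage_cost.
by rewrite -[S^T]mulmx1 qform_mul.
Qed.

Lemma feasible_state_dev : enorm (L *m y) ^+ 2 <= dX.
Proof.
case: feas => [[pL [dX0 _ _ _]] [_ [lmi _ _ _ _]]].
rewrite enorm_sqr; apply: le_trans (block_mx_bound y lmi) _.
by rewrite -[leRHS]mulr1 ler_wpM2l.
Qed.

Lemma feasible_input_dev : enorm (F *m y + l - ubar) ^+ 2 <= dU.
Proof.
case: feas => [[pL [_ _ phi0 _]] [_ [_ lmi _ _ _]]].
have := lmi_mx1_le phi0 y1 lmi.
by rewrite !trmxK addrA -enorm_sqr.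
Qed.

(** The argument of the form is the linearized successor of [L y + c], minus [cp], perturbed by a
    remainder [e] in the box. *)
Lemma feasible_target (e : 'cV[R]_nx) (w : 'cV[R]_nw) : posdef Pp ->
  conv_hull ws w ->
  (forall i, `|e i 0| <= 2^-1 * (dX + dU +
      \big[Num.max/0]_(j < Nw) enorm (ws j) ^+ 2) * Lip i 0) ->
  qform Pp ((A *m L + B *m F) *m y + (g + A *m c + B *m l - cp) + e + E *m w)
    <= 1.
Proof.
case: feas => _ [[beta0 _] [_ _ lmi _ _]] pP Ww eh.
pose h := (2^-1 * (dX + dU +
      \big[Num.max/0]_(j < Nw) enorm (ws j) ^+ 2)) *: Lip.
apply: (robust_ellipsoid (h := h) _ Ww).
- exact: posdef_possemidef.
- by move=> i; rewrite mxE.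
move=> s j; have := lmi_mx_le pP (beta0 (s, j)) y1 (lmi s j).
by rewrite -!linearD /= !trmxK !addrA.
Qed.

End Guarantees.

Theorem corollary1 (R : realType) (nx nu nw Nu Nw ns : nat)
    (mU : 'I_Nu -> nat)
    (X : set 'cV[R]_nx)
    (f : 'cV[R]_nx * 'cV[R]_nu * 'cV[R]_nw -> 'cV[R]_nx)
    (Lip : 'cV[R]_nx)
    (Uk : forall k : 'I_Nu, 'M[R]_(mU k, nu))
    (ws : 'I_Nw -> 'cV[R]_nw)
    (c cp : 'cV[R]_nx) (Pp : 'M[R]_nx)
    (Q : 'M[R]_(nx + nu + 1)) (S : 'M[R]_(ns, nx + nu + 1))
    (lam : R) (ubar : 'cV[R]_nu) :
  let U := input_set Uk in
  let W := conv_hull ws in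
  let xip := ellipsoid cp Pp in
  let pbar := (c, ubar, 0) in
  let A := jac_x f pbar in
  let B := jac_u f pbar in
  let E := jac_w f pbar in
  let g := lin_offset f pbar in
  let C := feasible A B E g Lip Uk ws c ubar cp Pp S in
  smooth_system f X U W Lip ->
  W 0 ->
  X c ->
  posdef Pp ->
  xip `<=` X ->
  Q = S^T *m S ->
  posdef Q ->
  0 <= lam <= 1 ->
  U ubar ->
  convex_set C /\
  convex_function C (objective lam) /\
  forall (L : 'M[R]_nx) (F : 'M[R]_(nu, nx)) (l : 'cV[R]_nu)
      (dX dU phi : R)
      (beta : {ffun {ffun 'I_nx -> bool} * 'I_Nw -> R^o})
      (tau : {ffun 'I_Nu -> R^o}) (gamma Jt : R),
    let xi := ellipsoid c (invmx (L *m L)) in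
    let kappa := ctrl (F *m invmx L) c l in
    is_minimizer C (objective lam)
      (L, F, l, dX, dU, phi, beta, tau, gamma, Jt) ->
    xi `<=` X ->
    (exists m : R,
       is_maximum [set stage_cost Q x (kappa x) | x in xi] m /\ m <= Jt) /\
    (forall x, xi x -> U (kappa x)) /\
    (forall x w, xi x -> W w -> xip (f (x, kappa x, w))).
Proof.
move=> U W xip pbar A B E g C sys W0 Xc pPp _ QS _ lam01 Uubar.
split; first exact: feasible_convex.
split; first exact: objective_convex.
move=> L F l dX dU phi beta tau gamma Jt xi kappa [feas _] xiX.
have pL : posdef L by case: feas => [[]].
have uL := posdef_unitmx pL.
have xiE : xi = [set L *m y + c | y in [set y | qform 1%:M y <= 1]].
  exact: ellipsoidP.
have kappaE y : kappa (L *m y + c) = F *m y + l.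
  by rewrite /kappa /ctrl addrK mulmxA mulmxKV.
split.
  have [m maxm] := stage_cost_max Q F c l pL; exists m; split=> //.
  (* The maximum is attained at some [L y + c], where [feasible_cost] bounds it. *)
  have [[x xix <-] _] := maxm; move: xix; rewrite -/xi xiE => -[y y1 <-].
  by rewrite -/kappa kappaE QS; exact: (feasible_cost feas y1).
split; rewrite xiE.
  by move=> _ [y y1 <-]; rewrite kappaE; exact: (feasible_input feas y1).
move=> _ w [y /= y1 <-] Ww; rewrite kappaE /xip /ellipsoid /=.
(* Displacement from the linearization point [pbar]. *)
pose d : 'cV[R]_nx * 'cV[R]_nu * 'cV[R]_nw := (L *m y, F *m y + l - ubar, w).
have dE : (L *m y + c, F *m y + l, w) = d + pbar.
  transitivity (L *m y + c, F *m y + l - ubar + ubar, w + 0); last by [].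
  by rewrite subrK addr0.
(* The state uses [t *: y] in the unit ball, the input lies between [ubar] and [kappa], and the
   disturbance between 0 and [w]. *)
have seg (t : R) : 0 <= t <= 1 -> (X `*` U `*` W) (t *: d + pbar).
  move=> t01; have [t0 t1] := andP t01; split; [split|].
  - apply: xiX; rewrite xiE; exists (t *: y); rewrite /= ?scalemxAr //.
    rewrite qformZ; apply: le_trans (_ : t ^+ 2 * 1 <= _).
      by rewrite ler_wpM2l // sqr_ge0.
    by rewrite mulr1 expr_le1.
  - have := input_set_convex t01 (feasible_input feas y1) Uubar.
    by congr (U _); rewrite /= scalerBr scalerBl scale1r addrA addrAC.
  - have := conv_hull_convex t01 Ww W0.
    by rewrite scaler0.
have dfp : differentiable f pbar.
  by case: sys => _ _ df _ _; apply: df; split; first split.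
pose e := f (d + pbar) - f pbar - 'd f pbar d.
have eh i : `|e i 0| <= 2^-1 * (dX + dU +
    \big[Num.max/0]_(j < Nw) enorm (ws j) ^+ 2) * Lip i 0.
  apply: le_trans (linearization_bound i sys seg) _.
  have Lip0 : 0 <= Lip i 0 by case: sys.
  (* [|d|^2] splits into state, input and disturbance parts, bounded by [dX], [dU] and the maximum
     over the generators: this is [r^2]. *)
  rewrite mulrAC ler_wpM2r // ler_wpM2l ?invr_ge0 // enorm_stack /=.
  rewrite !lerD ?(feasible_state_dev feas) ?(feasible_input_dev feas) //.
  exact: conv_hull_enorm.
have := feasible_target feas y1 pPp Ww eh.
(* The offset [g] cancels [f pbar] and the terms of the differential at [pbar], so linearization
   plus remainder is the exact successor. *)
suff -> : (A *m L + B *m F) *m y + (g + A *m c + B *m l - cp) + e + E *m w =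
    f (L *m y + c, F *m y + l, w) - cp by [].
rewrite dE /e (diff_jac _ dfp) -/A -/B -/E /g /lin_offset /= mulmx0 subr0.
rewrite -/A -/B mulmxBr mulmxDr mulmxDl -!mulmxA.
apply/matrixP => i j; rewrite !mxE; ring.
Qed.
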